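(* Let $\pi$ be a probability distribution concentrated on the slow state space $B$. Then for any $T>0$, $$\lim_{\lambda\to\infty}\ \sup_{0\le t\le T} d_{TV}\bigl(P^\lambda_\pi(X_t\in\cdot),\,P_\pi(Y_t\in\cdot)\bigr)=0 .$$
   Context: Setting. $S=\{1,\dots,|S|\}$ is a finite set. For each $\lambda>0$, $Q(\lambda)=(q_{ij}(\lambda))$ is an irreducible transition rate matrix on $S$ (nonnegative off-diagonal entries, rows summing to $0$), and $X=\{X_t:t\ge0\}$ is the continuous-time Markov chain on $S$ with transition rate matrix $Q(\lambda)$; $P^\lambda_\pi$ denotes its law with initial distribution $\pi$, and $P^\lambda_i$ its law started from state $i$. For all $i\ne j$, $\lim_{\lambda\to\infty}q_{ij}(\lambda)$ exists in $[0,\infty]$. Put $q_i(\lambda)=-q_{ii}(\lambda)=\sum_{j\ne i}q_{ij}(\lambda)$ and $q_i=\lim_{\lambda\to\infty}q_i(\lambda)\in[0,\infty]$. The fast state space is $A=\{i:q_i=\infty\}$ and the slow state space is $B=\{i:q_i<\infty\}$; it is assumed that $B\neq\emptyset$ and $q_i>0$ for all $i\in B$. States are labelled so that those of $A$ come first, and matrices on $S$ are written in blocks with indices $A,B$ (row vectors likewise). $Q=\lim_{\lambda\to\infty}Q(\lambda)$ entrywise; the blocks $Q_{BA},Q_{BB}$ have finite entries. Jump chain. $\Omega(\lambda)=(\omega_{ij}(\lambda))$ with $\omega_{ij}(\lambda)=q_{ij}(\lambda)/q_i(\lambda)$ for $i\neq j$ and $\omega_{ii}(\lambda)=0$. It is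 assumed that $\lim_{\lambda\to\infty}\omega_{ij}(\lambda)$ exists for all $i\ne j$; $\Omega=\lim_{\lambda\to\infty}\Omega(\lambda)$ is a stochastic matrix. Let $\eta=\{\eta_n\}_{n\ge0}$ be the discrete-time Markov chain with transition matrix $\Omega$ and $T_B=\inf\{n\ge0:\eta_n\in B\}$; it is assumed that $P_i(T_B<\infty)=1$ for all $i\in A$. Then $I-\Omega_{AA}$ is invertible. Reduced chain. $Y=\{Y_t:t\ge0\}$ is the continuous-time Markov chain on $B$ with transition rate matrix $\Gamma=Q_{BB}+Q_{BA}(I-\Omega_{AA})^{-1}\Omega_{AB}$; $P_\pi$ (resp. $P_i$) denotes its law with initial distribution $\pi$ on $B$ (resp. started from $i\in B$). Distributions on $B$ are regarded as distributions on $S$ giving mass $0$ to $A$. Total variation distance: $d_{TV}(\mu,\nu)=\frac12\sum_{i\in S}|\mu_i-\nu_i|$ for probability measures $\mu,\nu$ on $S$. *)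

(* Defs.v *)
From HB Require Import structures.
From mathcomp Require Import all_boot all_order all_algebra.
From mathcomp Require Import all_classical all_reals all_analysis.

Set Implicit Arguments.
Unset Strict Implicit.
Unset Printing Implicit Defensive.

Import Order.TTheory GRing.Theory Num.Theory.
Import numFieldNormedType.Exports.

Local Open Scope classical_set_scope.
Local Open Scope ring_scope.

(* Finite state spaces are ordinal types ['I_n]; a signed measure on ['I_n] is
   a row vector.  A state space split into a fast part followed by a slow part
   is ['I_(a + b)], so that the usual block operations on matrices apply. *)

Section Distributions.
Variables (R : realType) (n : nat).

Definition prob_vec (mu : 'rV[R]_n) : Prop :=
  (forall i, 0 <= mu 0 i) /\ \sum_i mu 0 i = 1.

Definition dirac_vec (i : 'I_n) : 'rV[R]_n := delta_mx 0 i.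

Definition dTV (mu nu : 'rV[R]_n) : R :=
  2^-1 * \sum_i `|mu 0 i - nu 0 i|.

Definition law_of d (E : measurableType d) (P : probability E R)
    (Z : E -> 'I_n) : 'rV[R]_n :=
  \row_i fine (P [set w | Z w = i]).

(* measurability with respect to the discrete sigma-algebra on ['I_n] *)
Definition discrete_rv d (E : measurableType d) (Z : E -> 'I_n) : Prop :=
  forall i, measurable [set w | Z w = i].

End Distributions.

Section MarkovChains.
Variables (R : realType) (n : nat).

Definition stochastic (M : 'M[R]_n) : Prop :=
  (forall i j, 0 <= M i j) /\ (forall i, \sum_j M i j = 1).

Definition rate_matrix (Q : 'M[R]_n) : Prop :=
  (forall i j, i != j -> 0 <= Q i j) /\ (forall i, \sum_j Q i j = 0).

Definition irreducible_rates (Q : 'M[R]_n) : Prop :=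
  forall i j, connect [rel x y | (x != y) && (0 < Q x y)] i j.

Definition transition_function (p : R -> 'M[R]_n) : Prop :=
  [/\ forall t, 0 <= t -> stochastic (p t),
      p 0 = 1%:M &
      forall s t, 0 <= s -> 0 <= t -> p (s + t) = p s *m p t].

Definition has_rates (p : R -> 'M[R]_n) (Q : 'M[R]_n) : Prop :=
  forall i j, h^-1 * (p h i j - (i == j)%:R) @[h --> 0^'+] --> Q i j.

(* [X t] is only constrained for [0 <= t].  The Markov property is stated
   through the finite-dimensional distributions, which avoids conditioning on
   events of probability zero. *)
Definition is_ctmc d (E : measurableType d) (P : probability E R)
    (mu : 'rV[R]_n) (Q : 'M[R]_n) (X : R -> E -> 'I_n) : Prop :=
  [/\ forall t, 0 <= t -> discrete_rv (X t),
      forall w t, 0 <= t -> \forall s \near t^'+, X s w = X t w &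
      exists p : R -> 'M[R]_n,
        [/\ transition_function p, has_rates p Q &
            forall (N : nat) (t : nat -> R) (x : nat -> 'I_n),
              t 0%N = 0 -> (forall k, (k < N)%N -> t k <= t k.+1) ->
              P [set w | forall k, (k <= N)%N -> X (t k) w = x k] =
              (mu 0 (x 0%N) *
               \prod_(k < N) p (t k.+1 - t k) (x k) (x k.+1))%:E]].

Definition is_dtmc d (E : measurableType d) (P : probability E R)
    (mu : 'rV[R]_n) (M : 'M[R]_n) (eta : nat -> E -> 'I_n) : Prop :=
  (forall k, discrete_rv (eta k)) /\
  forall (N : nat) (x : nat -> 'I_n),
    P [set w | forall k, (k <= N)%N -> eta k w = x k] =
    (mu 0 (x 0%N) * \prod_(k < N) M (x k) (x k.+1))%:E.

(* first hitting time; the infimum of the empty set is [+oo] *)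
Definition hitting_time (E : Type) (eta : nat -> E -> 'I_n) (C : set 'I_n)
    (w : E) : \bar R :=
  ereal_inf [set k%:R%:E | k in [set k | C (eta k w)]].

Definition exit_rate (Q : R -> 'M[R]_n) (lam : R) (i : 'I_n) : R :=
  - Q lam i i.

Definition exit_rate_lim (Q : R -> 'M[R]_n) (i : 'I_n) : \bar R :=
  lim ((exit_rate Q lam i)%:E @[lam --> +oo]).

Definition rate_lim (Q : R -> 'M[R]_n) : 'M[\bar R]_n :=
  \matrix_(i, j) lim ((Q lam i j)%:E @[lam --> +oo]).

Definition jump_matrix (Q : R -> 'M[R]_n) (lam : R) : 'M[R]_n :=
  \matrix_(i, j) if i == j then 0 else Q lam i j / exit_rate Q lam i.

Definition jump_lim (Q : R -> 'M[R]_n) : 'M[R]_n :=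
  \matrix_(i, j) lim (jump_matrix Q lam i j @[lam --> +oo]).

End MarkovChains.

Section Blocks.
Variables (R : realType) (a b : nat).

Definition slow_states : set 'I_(a + b) := range (@rshift a b).

Definition slow_vec (mu : 'rV[R]_b) : 'rV[R]_(a + b) := row_mx 0 mu.

(* Only rows of [rate_lim Q] indexed by slow states are used; their entries are
   finite, so [fine] loses nothing. *)
Definition reduced_rates (Q : R -> 'M[R]_(a + b)) : 'M[R]_b :=
  let Om := jump_lim Q in
  map_mx fine (drsubmx (rate_lim Q)) +
  map_mx fine (dlsubmx (rate_lim Q)) *m
    invmx (1%:M - ulsubmx Om) *m ursubmx Om.

End Blocks.

Arguments slow_states : clear implicits.
Arguments slow_vec {R} a {b} mu.

(* Main.v *)
(* The laws mu(t) of the fast-slow chain are compared with the laws y(t) of the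
   reduced chain on a time grid of mesh h -> 0, so that only p(h) = 1 + h Q + o(h)
   is needed, and no differentiability of the transition functions.  Write
   K = Omega_AA, H = (1 - K)^-1 Omega_AB and w = (1 - K)^-1 1 >= 1, all built from
   the limiting jump chain.

   The weighted fast mass g = mu_A w satisfies g' <= - phi / 2 + C, where
   phi = sum_i mu_i q_i over the fast states: since phi is at least
   (min q) g / max w, the fast mass is uniformly small, and the time integral of
   phi is bounded.  The projection z = mu_A H + mu_B satisfies z(0) = y(0) and
   z' = z Gamma + O(eta) phi + O(g) + O(eta), because Q(lambda) (H, 1)^T has fast
   rows q_i o(1) and slow rows Gamma + o(1).  Hence z is close to y, and mu is
   close to (0, z) because the fast mass is small. *)
Require Import Defs.
From HB Require Import structures.
From mathcomp Require Import all_boot all_order all_algebra.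
From mathcomp Require Import all_classical all_reals all_analysis.
From mathcomp Require Import ring lra.

Set Implicit Arguments.
Unset Strict Implicit.
Unset Printing Implicit Defensive.

Import Order.TTheory GRing.Theory Num.Theory.
Import numFieldNormedType.Exports.

Local Open Scope classical_set_scope.
Local Open Scope ring_scope.

(** * The l1 norm of row vectors and its behaviour under matrix products *)

Section L1Norm.
Variable R : realType.

Definition l1 n (v : 'rV[R]_n) : R := \sum_i `|v 0 i|.

Lemma l1_ge0 n (v : 'rV[R]_n) : 0 <= l1 v.
Proof. by apply: sumr_ge0 => i _. Qed.

Lemma l10 n : l1 (0 : 'rV[R]_n) = 0.
Proof. by rewrite /l1 big1 // => i _; rewrite mxE normr0. Qed.

Lemma l1D n (u v : 'rV[R]_n) : l1 (u + v) <= l1 u + l1 v.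
Proof.
rewrite /l1 -big_split /=; apply: ler_sum => i _.
by rewrite mxE ler_normD.
Qed.

Lemma l1N n (u : 'rV[R]_n) : l1 (- u) = l1 u.
Proof. by apply: eq_bigr => i _; rewrite mxE normrN. Qed.

Lemma l1B n (u v : 'rV[R]_n) : l1 (u - v) <= l1 u + l1 v.
Proof. by rewrite -(l1N v) l1D. Qed.

Lemma l1Z n c (u : 'rV[R]_n) : l1 (c *: u) = `|c| * l1 u.
Proof. by rewrite /l1 mulr_sumr; apply: eq_bigr => i _; rewrite mxE normrM. Qed.

Lemma l1_row_mx a b (u : 'rV[R]_a) (v : 'rV[R]_b) :
  l1 (row_mx u v) = l1 u + l1 v.
Proof.
rewrite /l1 big_split_ord /=; congr (_ + _);
  by apply: eq_bigr => i _; rewrite ?row_mxEl ?row_mxEr.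
Qed.

(** The bound depends on the row, since the fast rows will only be controlled up to the factor
    [q i], which grows without limit. *)
Lemma l1_mulmx m n (v : 'rV[R]_m) (M : 'M[R]_(m, n)) (c : 'I_m -> R) :
  (forall i, l1 (row i M) <= c i) -> l1 (v *m M) <= \sum_i `|v 0 i| * c i.
Proof.
move=> Mc; apply: (@le_trans _ _ (\sum_i `|v 0 i| * l1 (row i M))); last first.
  by apply: ler_sum => i _; rewrite ler_wpM2l.
under [leRHS]eq_bigr do rewrite mulr_sumr.
rewrite exchange_big /=; apply: ler_sum => j _; rewrite mxE.
apply: le_trans (ler_norm_sum _ _ _) _.
by apply: ler_sum => i _; rewrite normrM mxE.
Qed.

Lemma l1_mulmx_cst m n (v : 'rV[R]_m) (M : 'M[R]_(m, n)) (c : R) :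
  (forall i, l1 (row i M) <= c) -> l1 (v *m M) <= l1 v * c.
Proof. by move=> Mc; rewrite /l1 mulr_suml; apply: l1_mulmx. Qed.

Lemma prob_vec_l1 n (v : 'rV[R]_n) : prob_vec v -> l1 v = 1.
Proof. by case=> v0 <-; apply: eq_bigr => i _; rewrite ger0_norm. Qed.

Lemma stochastic_l1 n (M : 'M[R]_n) i : stochastic M -> l1 (row i M) = 1.
Proof.
by case=> M0 M1; rewrite -(M1 i); apply: eq_bigr => j _; rewrite mxE ger0_norm.
Qed.

Lemma l1_mul_stochastic n (v : 'rV[R]_n) (M : 'M[R]_n) :
  stochastic M -> l1 (v *m M) <= l1 v.
Proof.
move=> sM; rewrite -[leRHS]mulr1; apply: l1_mulmx_cst => i.
by rewrite stochastic_l1.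
Qed.

Lemma prob_vec_mul n (v : 'rV[R]_n) (M : 'M[R]_n) :
  prob_vec v -> stochastic M -> prob_vec (v *m M).
Proof.
move=> [v0 v1] [M0 M1]; split=> [j|].
  by rewrite mxE sumr_ge0 // => i _; rewrite mulr_ge0.
under eq_bigr do rewrite mxE.
rewrite exchange_big /= -v1; apply: eq_bigr => i _.
by rewrite -mulr_sumr M1 mulr1.
Qed.

Lemma prob_slow_vec a b (v : 'rV[R]_b) : prob_vec v -> prob_vec (slow_vec a v).
Proof.
move=> [v0 v1]; split=> [i|].
  by rewrite /slow_vec mxE; case: (fintype.split i) => j //; rewrite mxE.
rewrite big_split_ord /= big1 ?add0r => [|i _]; last by rewrite row_mxEl mxE.
by rewrite -v1; apply: eq_bigr => i _; rewrite row_mxEr.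
Qed.

Lemma dTV_l1 n (u v : 'rV[R]_n) : dTV u v = 2^-1 * l1 (u - v).
Proof. by congr (_ * _); apply: eq_bigr => i _; rewrite !mxE. Qed.

Lemma l1_row_scalar1 n (i : 'I_n) : l1 (row i (1%:M : 'M[R]_n)) = 1.
Proof.
rewrite row1 /l1 (bigD1 i) //= mxE !eqxx normr1 big1 ?addr0 // => j ji.
by rewrite mxE (negPf ji) andbF normr0.
Qed.

End L1Norm.

(** * Comparison of two discrete-time chains with one-step matrices [M] and [P], close to 1 + h Q
    and 1 + h G *)

Section DiscreteComparison.
Variables (R : realType) (a b : nat).
Variables (M Q : 'M[R]_(a + b)) (P G : 'M[R]_b) (H : 'M[R]_(a, b)).
Variables (w : 'cV[R]_a) (q : 'I_a -> R) (h eps eta k W C c : R).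
Hypotheses (M_sto : stochastic M) (P_sto : stochastic P).
Hypotheses (h_ge0 : 0 <= h) (eps_ge0 : 0 <= eps) (eta_ge0 : 0 <= eta).
Hypotheses (k_gt0 : 0 < k) (C_ge0 : 0 <= C) (c_ge1 : 1 <= c).
Hypotheses (M_rates : forall i, l1 (row i (M - 1%:M - h *: Q)) <= h * eps)
           (P_rates : forall i, l1 (row i (P - 1%:M - h *: G)) <= h * eps).
Hypotheses (q_large : forall i, k <= q i)
           (w_ge1 : forall i, 1 <= w i 0) (w_le : forall i, w i 0 <= W).
Hypothesis w_drift : forall i, (ulsubmx Q *m w) i 0 <= - (q i / 2).
Hypothesis w_drift_slow : forall i, (dlsubmx Q *m w) i 0 <= C.
Hypothesis H_harmonic :
  forall i, l1 (row i (ulsubmx Q *m H + ursubmx Q)) <= q i * eta.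
Hypothesis G_close :
  forall i, l1 (row i (dlsubmx Q *m H + drsubmx Q - G)) <= eta.
Hypotheses (H_le : forall i, l1 (row i H) <= c)
           (HG_le : forall i, l1 (row i (H *m G)) <= c).
Hypotheses (epsW : eps * W <= 1) (W_gt0 : 0 < W) (hk : h * k <= 2 * W)
           (k_large : 2 * W * (C + 1) <= eta * k).

Let c_ge0 : 0 <= c. Proof. exact: le_trans c_ge1. Qed.
Let w_ge0 i : 0 <= w i 0. Proof. exact: le_trans (w_ge1 i). Qed.
(** [mu *m L] is the projection z of the idea: mass at a fast state is sent to the slow states with
    the weights in its row of [H]. *)
Let L : 'M[R]_(a + b, b) := col_mx H 1%:M.
Let phi (mu : 'rV[R]_(a + b)) := \sum_i mu 0 (lshift b i) * q i.
Let g (mu : 'rV[R]_(a + b)) := \sum_i mu 0 (lshift b i) * w i 0.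

Lemma fast_mass_ge0 mu : prob_vec mu -> 0 <= g mu.
Proof.
move=> [mu0 _]; apply: sumr_ge0 => i _.
by rewrite mulr_ge0.
Qed.

Lemma fast_mass_phi mu : prob_vec mu -> k * g mu <= W * phi mu.
Proof.
move=> [mu0 _]; rewrite !mulr_sumr; apply: ler_sum => i _.
by rewrite mulrCA [leRHS]mulrCA ler_wpM2l // mulrC ler_pM // ltW.
Qed.

(** Write mu M = mu + h mu Q + error and pair with (w, 0). The drift hypotheses on w bound the
    middle term by h (C - phi / 2); the error costs at most h eps W <= h, which is the extra 1 next
    to [C]. *)
Lemma fast_mass_step mu : prob_vec mu ->
  g (mu *m M) <= g mu - h / 2 * phi mu + h * (C + 1).
Proof.
move=> pmu; have [mu0 mu1] := pmu.
pose V : 'cV[R]_(a + b) := col_mx w 0.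
have gE nu : g nu = (nu *m V) 0 0.
  rewrite mxE big_split_ord /= [X in _ + X]big1 ?addr0 => [|i _]; last first.
    by rewrite col_mxEd mxE mulr0.
  by apply: eq_bigr => i _; rewrite col_mxEu.
have -> : mu *m M = mu + h *: (mu *m Q) + mu *m (M - 1%:M - h *: Q).
  by rewrite !mulmxBr mulmx1 -scalemxAr; apply/rowP => i; rewrite !mxE; ring.
rewrite !gE mulmxDl mulmxDl -scalemxAl.
have mxD (A B : 'M[R]_1) : (A + B) 0 0 = A 0 0 + B 0 0 by rewrite mxE.
have mxZ (A : 'M[R]_1) : (h *: A) 0 0 = h * A 0 0 by rewrite mxE.
rewrite !mxD mxZ {mxD mxZ}.
have QV : (mu *m Q *m V) 0 0 <= - (phi mu / 2) + C.
  rewrite -mulmxA -{1}(submxK Q) /V mul_block_col !mulmx0 !addr0.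
  rewrite mxE big_split_ord /=; apply: lerD.
    rewrite mulr_suml -sumrN; apply: ler_sum => i _.
    by rewrite col_mxEu -mulrA -mulrN ler_wpM2l.
  apply: (@le_trans _ _ (\sum_i mu 0 (rshift a i) * C)).
    by apply: ler_sum => i _; rewrite col_mxEd ler_wpM2l.
  rewrite -mulr_suml -[leRHS]mul1r ler_wpM2r //.
  by rewrite -mu1 big_split_ord /= lerDr sumr_ge0.
have EV : (mu *m (M - 1%:M - h *: Q) *m V) 0 0 <= h.
  have: l1 (mu *m (M - 1%:M - h *: Q) *m V) <= h * eps * W.
    apply: (@le_trans _ _ (l1 (mu *m (M - 1%:M - h *: Q)) * W)).
      apply: l1_mulmx_cst => i; rewrite /l1 big_ord1 mxE -(splitK i).
      case: (fintype.split i) => j /=; rewrite ?col_mxEu ?col_mxEd.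
        by rewrite ger0_norm.
      by rewrite mxE normr0 ltW.
    rewrite ler_wpM2r ?(ltW W_gt0) //.
    by rewrite (le_trans (l1_mulmx_cst _ M_rates)) // prob_vec_l1 // mul1r.
  rewrite /l1 big_ord1 => /(le_trans (ler_norm _)) /le_trans; apply.
  by rewrite -mulrA ler_piMr.
have := ler_wpM2l h_ge0 QV.
move: QV EV; set x := (X in X <= _ -> _); set z := (_ *m _ *m V) 0 0.
set m := (mu *m V) 0 0.
move: (phi mu) => f QV EV QV'.
lra.
Qed.

(** Since L intertwines the identities, M L - L P equals h (Q L - L G) up to the two one-step
    errors, which give [2 * c * eps]. The fast rows of Q L - L G are a harmonicity defect, weighted
    by [phi], minus H G, which is only bounded but is weighted by the fast mass; the slow rows are
    O(eta). *)
Lemma intertwining_defect mu : prob_vec mu ->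
  l1 (mu *m (M *m L - L *m P)) <=
  h * (phi mu * eta + c * g mu + eta + 2 * c * eps).
Proof.
move=> pmu; have [mu0 mu1] := pmu.
pose D : 'M[R]_(a + b, b) :=
  col_mx (ulsubmx Q *m H + ursubmx Q) (dlsubmx Q *m H + drsubmx Q - G).
pose D' : 'M[R]_(a + b, b) := col_mx (H *m G) 0.
have QLG : Q *m L - L *m G = D - D'.
  rewrite -{1}(submxK Q) /L mul_block_col !mulmx1 mul_col_mx mul1mx.
  by rewrite /D /D' !opp_col_mx !add_col_mx oppr0 addr0.
have L_le i : l1 (row i L) <= c.
  rewrite -(splitK i); case: (fintype.split i) => j /=; rewrite ?rowKu ?rowKd //.
  by rewrite l1_row_scalar1.
have -> : mu *m (M *m L - L *m P) =
  h *: (mu *m D) - h *: (mu *m D') + mu *m (M - 1%:M - h *: Q) *m L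
  - mu *m L *m (P - 1%:M - h *: G).
  rewrite -scalerBr -mulmxBr -QLG.
  rewrite !mulmxBr !mulmxBl !mulmx1 -!scalemxAr -!scalemxAl !mulmxA.
  by apply/rowP => i; rewrite !mxE; ring.
have lD : l1 (mu *m D) <= phi mu * eta + eta.
  apply: (@le_trans _ _ (\sum_i `|mu 0 i| *
      match fintype.split i with inl j => q j * eta | inr _ => eta end)).
    apply: l1_mulmx => i; rewrite -{1}(splitK i).
    by case: (fintype.split i) => j /=; rewrite ?rowKu ?rowKd.
  rewrite big_split_ord /= mulr_suml; apply: lerD.
    apply: ler_sum => i _.
    by rewrite (unsplitK (inl i : 'I_a + 'I_b)) ger0_norm // mulrA.
  under eq_bigr => i _
    do rewrite (unsplitK (inr i : 'I_a + 'I_b)) ger0_norm //.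
  rewrite -mulr_suml -[leRHS]mul1r ler_wpM2r //.
  by rewrite -mu1 big_split_ord /= lerDr sumr_ge0.
have lD' : l1 (mu *m D') <= c * g mu.
  apply: (@le_trans _ _ (\sum_i `|mu 0 i| *
      match fintype.split i with inl _ => c | inr _ => 0 end)).
    apply: l1_mulmx => i; rewrite -{1}(splitK i).
    case: (fintype.split i) => j /=; rewrite ?rowKu ?rowKd //.
    by rewrite row0 l10.
  rewrite big_split_ord /= mulr_sumr [X in _ + X]big1 ?addr0; last first.
    by move=> i _; rewrite (unsplitK (inr i : 'I_a + 'I_b)) mulr0.
  apply: ler_sum => i _.
  rewrite (unsplitK (inl i : 'I_a + 'I_b)) ger0_norm // [leLHS]mulrC.
  (* As w >= 1, the plain fast mass is at most the weighted one. *)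
  have := ler_wpM2l (mu0 (lshift b i)) (w_ge1 i); rewrite mulr1.
  exact: ler_wpM2l.
have lE : l1 (mu *m (M - 1%:M - h *: Q) *m L) <= h * eps * c.
  apply: le_trans (l1_mulmx_cst _ L_le) _.
  rewrite ler_wpM2r //.
  by rewrite (le_trans (l1_mulmx_cst _ M_rates)) // prob_vec_l1 // mul1r.
have lE' : l1 (mu *m L *m (P - 1%:M - h *: G)) <= c * (h * eps).
  apply: le_trans (l1_mulmx_cst _ P_rates) _.
  rewrite ler_wpM2r ?mulr_ge0 //.
  by rewrite (le_trans (l1_mulmx_cst _ L_le)) // prob_vec_l1 // mul1r.
apply: le_trans (l1B _ _) _.
have s1 := l1D (h *: (mu *m D) - h *: (mu *m D'))
            (mu *m (M - 1%:M - h *: Q) *m L).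
have s2 := l1B (h *: (mu *m D)) (h *: (mu *m D')).
rewrite !l1Z !ger0_norm // in s2.
have s3 := ler_wpM2l h_ge0 lD; have s4 := ler_wpM2l h_ge0 lD'.
lra.
Qed.

Variable pi : 'rV[R]_b.
Hypothesis pi_prob : prob_vec pi.

Let mu n := iter n (mulmxr M) (slow_vec a pi).
Let y n := iter n (mulmxr P) pi.

Lemma prob_vec_iter n : prob_vec (mu n).
Proof.
elim: n => [|n IHn]; first exact: prob_slow_vec.
exact: prob_vec_mul.
Qed.

Lemma fast_mass0 : g (mu 0) = 0.
Proof.
by rewrite /g big1 // => i _; rewrite /mu /= /slow_vec row_mxEl mxE mul0r.
Qed.

(** The interval below [eta] is invariant: [phi] is at least (k / W) g, so one step gives at most (1
    - h k / (2 W)) g + h (C + 1), and [k_large] says that C + 1 <= eta k / (2 W). *)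
Lemma fast_mass_small n : g (mu n) <= eta.
Proof.
elim: n => [|n IHn]; first by rewrite fast_mass0.
have pn := prob_vec_iter n.
have step := fast_mass_step pn; have low := fast_mass_phi pn.
apply: le_trans step _.
have gphi : k / W * g (mu n) <= phi (mu n).
  by rewrite mulrAC ler_pdivrMr // [leRHS]mulrC.
have h1 : 0 <= h / 2 by rewrite divr_ge0.
have s1 := ler_wpM2l h1 gphi.
(* The induction hypothesis may be multiplied by this contraction factor only because it is
   nonnegative, which is the role of [hk]. *)
have hW : 0 <= 1 - h / 2 * (k / W).
  rewrite subr_ge0 mulrA ler_pdivrMr // mul1r; move: hk; lra.
have s2 := ler_wpM2l hW IHn.
have s3 : C + 1 <= eta * (k / W) / 2.
  rewrite mulrA -mulrA -invfM ler_pdivlMr ?mulr_gt0 //; move: k_large; lra.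
have s4 := ler_wpM2l h_ge0 s3.
lra.
Qed.

(* The term [2 * eta * g] is a Lyapunov correction: its decrease absorbs the
   contribution [phi * eta] of the fast states, whose rates are unbounded. *)
Lemma discrete_comparison n :
  l1 (mu n *m L - y n) + 2 * eta * g (mu n) <=
  n%:R * (h * (eta * (2 * C + 3 + c) + 2 * c * eps)).
Proof.
elim: n => [|n IHn].
  rewrite mul0r fast_mass0 mulr0 addr0 /mu /y /= /slow_vec /L mul_row_col.
  by rewrite mul0mx add0r mulmx1 subrr l10.
have pn := prob_vec_iter n.
have def := intertwining_defect pn; have step := fast_mass_step pn.
have small := fast_mass_small n.
have e : mu n.+1 *m L - y n.+1 =
    mu n *m (M *m L - L *m P) + (mu n *m L - y n) *m P.
  rewrite /mu /y !iterS /= -/(mu n) -/(y n) mulmxBr mulmxBl !mulmxA.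
  by rewrite addrA subrK.
rewrite e; have t1 := l1D (mu n *m (M *m L - L *m P)) ((mu n *m L - y n) *m P).
have t2 := l1_mul_stochastic (mu n *m L - y n) P_sto.
have e2 : mu n.+1 = mu n *m M by [].
rewrite e2 -natr1 mulrDl mul1r.
have eta2 : 0 <= 2 * eta by rewrite mulr_ge0.
have t3 := ler_wpM2l eta2 step.
have hc : 0 <= h * c by rewrite mulr_ge0.
have t4 := ler_wpM2l hc small.
lra.
Qed.

(** With mu = (u, v), the fast part u has norm at most g, and v differs from the projection z only
    by u H; both are O(eta) by [fast_mass_small]. *)
Lemma discrete_comparison_full n :
  l1 (mu n - slow_vec a (y n)) <=
  eta * (1 + c) + n%:R * h * (eta * (2 * C + 3 + c) + 2 * c * eps).
Proof.
have pn := prob_vec_iter n; have [mun0 _] := pn.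
set u := lsubmx (mu n); set v := rsubmx (mu n).
have lu : l1 u <= g (mu n).
  apply: ler_sum => i _; rewrite /u mxE ger0_norm //.
  by rewrite -[leLHS]mulr1 ler_wpM2l.
have small := fast_mass_small n.
rewrite -(hsubmxK (mu n)) -/u -/v /slow_vec opp_row_mx add_row_mx oppr0 addr0.
rewrite l1_row_mx.
have -> : v - y n = (mu n *m L - y n) - u *m H.
  rewrite -(hsubmxK (mu n)) -/u -/v /L mul_row_col mulmx1.
  by rewrite [u *m H + v]addrC -!addrA; congr (_ + _); rewrite addrCA subrr addr0.
have t1 := l1B (mu n *m L - y n) (u *m H).
have t2 := l1_mulmx_cst u H_le.
have t3 : l1 u * c <= eta * c.
  by rewrite ler_wpM2r // (le_trans lu).
have t4 := discrete_comparison n.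
have t5 : 0 <= 2 * eta * g (mu n).
  by rewrite !mulr_ge0 // fast_mass_ge0.
lra.
Qed.

End DiscreteComparison.

(** * From one-step estimates to transition functions in continuous time *)

Section TransitionFunctions.
Variable R : realType.

Lemma has_rates_approx n (p : R -> 'M[R]_n) (Q : 'M[R]_n) (e : R) :
  has_rates p Q -> 0 < e ->
  \forall h \near 0^'+, forall i, l1 (row i (p h - 1%:M - h *: Q)) <= h * e.
Proof.
(* A row has n entries, each allowed the error e'; dividing by n + 1 also covers n = 0. *)
move=> pQ e0; pose e' := e / n.+1%:R.
have e'0 : 0 < e' by rewrite divr_gt0.
have H : \forall h \near 0^'+, forall i j,
    `|Q i j - h^-1 * (p h i j - (i == j)%:R)| <= e'.
  apply: filter_forall => i; apply: filter_forall => j.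
  have /cvgrPdist_le := pQ i j; exact.
near=> h => i; have h0 : 0 < h by near: h; exact: nbhs_right_gt.
have Hh : forall i j, `|Q i j - h^-1 * (p h i j - (i == j)%:R)| <= e'.
  by near: h.
apply: (@le_trans _ _ (\sum_(j < n) h * e')).
  apply: ler_sum => j _.
  have -> : row i (p h - 1%:M - h *: Q) 0 j =
      - h * (Q i j - h^-1 * (p h i j - (i == j)%:R)).
    by rewrite !mxE; field; rewrite gt_eqF.
  rewrite normrM normrN (gtr0_norm h0).
  by apply: ler_wpM2l; rewrite ?Hh // ltW.
rewrite sumr_const card_ord -mulrnAr ler_pM2l // /e' -mulr_natr -mulrA.
by rewrite ler_piMr ?(ltW e0) // mulrC ler_pdivrMr // mul1r ler_nat.
Unshelve. all: by end_near. Qed.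

Lemma transition_iter n (p : R -> 'M[R]_n) (v : 'rV[R]_n) h k :
  transition_function p -> 0 <= h ->
  v *m p (k%:R * h) = iter k (mulmxr (p h)) v.
Proof.
move=> [_ p0 pD] h0; elim: k => [|k IHk]; first by rewrite mul0r p0 mulmx1.
by rewrite iterS -IHk -natr1 mulrDl mul1r pD ?mulr_ge0 // mulmxA.
Qed.

(** Fix t and write t = n h with h so small that the o(h) errors of both transition functions are
    below h e. The discrete comparison then applies, and its bound involves h only through n h = t
    <= T, so a single mesh suffices and no limit in h is taken. *)
Lemma semigroup_comparison a b (p : R -> 'M[R]_(a + b)) (P : R -> 'M[R]_b)
    (Q : 'M[R]_(a + b)) (G : 'M[R]_b) (H : 'M[R]_(a, b)) (w : 'cV[R]_a)
    (q : 'I_a -> R) (eta k W C c T t : R) (pi : 'rV[R]_b) :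
  transition_function p -> has_rates p Q ->
  transition_function P -> has_rates P G ->
  0 < eta -> 0 < k -> 0 <= C -> 1 <= c -> 0 < W ->
  (forall i, k <= q i) -> (forall i, 1 <= w i 0) -> (forall i, w i 0 <= W) ->
  (forall i, (ulsubmx Q *m w) i 0 <= - (q i / 2)) ->
  (forall i, (dlsubmx Q *m w) i 0 <= C) ->
  (forall i, l1 (row i (ulsubmx Q *m H + ursubmx Q)) <= q i * eta) ->
  (forall i, l1 (row i (dlsubmx Q *m H + drsubmx Q - G)) <= eta) ->
  (forall i, l1 (row i H) <= c) -> (forall i, l1 (row i (H *m G)) <= c) ->
  2 * W * (C + 1) <= eta * k ->
  prob_vec pi -> 0 <= t <= T ->
  dTV (slow_vec a pi *m p t) (slow_vec a (pi *m P t)) <=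
  eta * (1 + c + T * (2 * C + 3 + 3 * c)).
Proof.
move=> tp pQ tP PG eta0 k0 C0 c1 W0 qk w1 wW wd ws Hh Gc Hc HG kl ppi.
move=> /andP[t0 tT].
(* The bound by [eta] absorbs the one-step errors into the final estimate; the bound by 1 / W gives
   the hypothesis eps W <= 1. *)
pose e := Num.min eta W^-1.
have e0 : 0 < e by rewrite lt_min eta0 invr_gt0.
have T0 : 0 <= T by apply: le_trans tT.
have near_h : \forall h \near (0 : R)^'+,
    [/\ forall i, l1 (row i (p h - 1%:M - h *: Q)) <= h * e,
        forall i, l1 (row i (P h - 1%:M - h *: G)) <= h * e &
        h < 2 * W / k].
  have A1 := has_rates_approx pQ e0; have A2 := has_rates_approx PG e0.
  have A3 : \forall h \near (0 : R)^'+, h < 2 * W / k.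
    by apply: nbhs_right_lt; rewrite divr_gt0 // mulr_gt0.
  near=> h; split; last by near: h.
  - by near: h.
  - by near: h.
have [h [n [h0 tE [Mr Pr hk]]]] : exists h n,
    [/\ 0 <= h, t = n%:R * h &
    [/\ forall i, l1 (row i (p h - 1%:M - h *: Q)) <= h * e,
        forall i, l1 (row i (P h - 1%:M - h *: G)) <= h * e &
        h < 2 * W / k]].
  (* For t = 0 no positive mesh divides t into a positive number of steps; h = 0 with no step works
     since both transition functions start at 1. *)
  have [->|t_neq0] := eqVneq t 0.
    exists 0, 0%N; split; rewrite ?mulr0 //; split.
    - by move=> i; case: tp => _ -> _;
        rewrite subrr scale0r subrr row0 l10 mul0r.
    - by move=> i; case: tP => _ -> _;
        rewrite subrr scale0r subrr row0 l10 mul0r.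
    - by rewrite divr_gt0 // mulr_gt0.
  have t_gt0 : 0 < t by rewrite lt_def t_neq0.
  have [d /= d0 dP] := near_h.
  (* The successor makes n positive and strictly larger than t / d, hence t / n < d. *)
  pose n := (Num.truncn (t / d)).+1.
  have n0 : 0 < n%:R :> R by rewrite ltr0n.
  exists (t / n%:R), n; split.
  - by rewrite divr_ge0.
  - by rewrite mulrC divfK // gt_eqF.
  - apply: dP; last by rewrite divr_gt0.
    rewrite /ball_ /= sub0r normrN gtr0_norm ?divr_gt0 //.
    by rewrite ltr_pdivrMr // mulrC -ltr_pdivrMr // truncnS_gt.
have sM : stochastic (p h) by case: tp => + _ _; apply.
have sP : stochastic (P h) by case: tP => + _ _; apply.
rewrite tE !transition_iter //.
have eW : e * W <= 1.
  rewrite -(@mulVf _ W) ?gt_eqF // ler_pM2r //.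
  by rewrite ge_min lexx orbT.
have hkW : h * k <= 2 * W by rewrite -ler_pdivlMr // ltW.
have := @discrete_comparison_full R a b (p h) Q (P h) G H w q h e eta k W C c
  sM sP h0 (ltW e0) (ltW eta0) k0 C0 c1 Mr Pr qk w1 wW wd ws Hh Gc Hc HG
  eW W0 hkW kl pi ppi n.
rewrite -tE dTV_l1; set D := l1 _ => D_le.
have e_eta : e <= eta by rewrite ge_min lexx.
have c0 : 0 <= 2 * c by lra.
have s1 := ler_wpM2l c0 e_eta.
set B := eta * (2 * C + 3 + c) + 2 * c * e in D_le.
have B0 : 0 <= B.
  by rewrite /B addr_ge0 // mulr_ge0 // ?(ltW eta0) ?(ltW e0) //; lra.
have s2 : t * B <= T * (eta * (2 * C + 3 + 3 * c)).
  rewrite ler_pM // /B; lra.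
have D0 : 0 <= D by apply: l1_ge0.
lra.
Unshelve. all: by end_near. Qed.

End TransitionFunctions.

(** * Marginal laws of a continuous-time chain *)

Section Laws.
Variable R : realType.

Lemma measure_rv_partition d (E : measurableType d) (P : probability E R) n
    (Z : E -> 'I_n) (A : set E) :
  discrete_rv Z -> measurable A ->
  P A = (\sum_(i < n) P (A `&` [set w | Z w = i]))%E.
Proof.
move=> mZ mA; rewrite -measure_bigsetU_ord_cond.
- congr (P _); rewrite -bigcup_seq; apply/seteqP; split=> [w Aw|w [i _ []]//].
  by exists (Z w) => //=; rewrite mem_index_enum.
- by move=> i _; exact: measurableI.
- apply/trivIsetP => i j _ _ /eqP ij.
  by apply/seteqP; split=> // w [[_ wi] [_ wj]]; case: ij; rewrite -wi -wj.
Qed.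

(** The finite-dimensional law at the two times 0 and t, summed over the initial state, is the
    vector-matrix product. *)
Lemma law_of_ctmc d (E : measurableType d) (P : probability E R) n
    (mu : 'rV[R]_n) (Q : 'M[R]_n) (X : R -> E -> 'I_n) :
  is_ctmc P mu Q X ->
  exists p, [/\ transition_function p, has_rates p Q &
    forall t, 0 <= t -> law_of P (X t) = mu *m p t].
Proof.
move=> [mX _ [p [tp pQ fdd]]]; exists p; split=> // t t0.
apply/rowP => i; rewrite mxE.
rewrite (measure_rv_partition _ (mX _ (lexx 0)) (mX _ t0 i)).
rewrite mxE -[RHS]/(fine (_%:E)) -sumEFin; congr fine; apply: eq_bigr => j _.
have := fdd 1%N (fun k => if k == 0%N then 0 else t)
  (fun k => if k == 0%N then j else i).
rewrite big_ord1 /= subr0 => <- //; last by case.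
congr (P _); apply/seteqP; split=> [w [/= Xi Xj] [|[|]]//|w /= H].
by split; [have := H 1%N isT|have := H 0%N isT].
Qed.

(** * Survival of the limiting jump chain among the fast states *)

Lemma measurable_cylinder d (E : measurableType d) n (D : set nat)
    (eta : nat -> E -> 'I_n) (S : nat -> set 'I_n) :
  (forall k, discrete_rv (eta k)) ->
  measurable [set w | forall k, D k -> S k (eta k w)].
Proof.
move=> mE.
have -> : [set w | forall k, D k -> S k (eta k w)] =
    \bigcap_(k in D) eta k @^-1` S k by [].
apply: bigcap_measurableType => k _.
have -> : eta k @^-1` S k =
    \bigcup_(i in S k) [set w | eta k w = i].
  apply/seteqP; split=> [w Sw|w [i Si e]]; first by exists (eta k w).
  by rewrite /preimage /= e.
apply: fin_bigcup_measurable => [|i _]; last exact: mE.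
exact: finite_finset.
Qed.

(** The vector K^m 1; for K = Omega_AA its entry at i is the probability of staying in the fast
    states for m steps from i. *)
Definition survival a (K : 'M[R]_a) m : 'cV[R]_a :=
  iter m (mulmx K) (const_mx 1).

Section Survival.
Variables (a b : nat) (d : measure_display) (E : measurableType d).
Variables (P : probability E R) (mu : 'rV[R]_(a + b)) (Om : 'M[R]_(a + b)).
Variable eta : nat -> E -> 'I_(a + b).
Hypothesis eta_chain : is_dtmc P mu Om eta.

(** An arbitrary prefix [x] ending at a fast state makes the induction on m work without
    conditioning: the event is split by the state at time N + 1, slow values contribute nothing, and
    a fast value is appended to the prefix. *)
Lemma dtmc_survival m N (x : nat -> 'I_(a + b)) (i : 'I_a) :
  x N = lshift b i ->
  P ([set w | forall k, (k <= N)%N -> eta k w = x k] `&`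
     [set w | forall k, (N < k <= N + m)%N -> ~ slow_states a b (eta k w)]) =
  (mu 0 (x 0%N) * \prod_(k < N) Om (x k) (x k.+1)
     * survival (ulsubmx Om) m i 0)%:E.
Proof.
have [meta fdd] := eta_chain.
elim: m N x i => [|m IHm] N x i xN.
  rewrite mxE mulr1 -fdd; congr (P _); apply/seteqP; split=> [w []//|w H].
  split=> // k /=; rewrite addn0 => /andP[Nk kN].
  by rewrite leqNgt Nk in kN.
rewrite (measure_rv_partition _ (meta N.+1)); last first.
  apply: measurableI.
    exact: (@measurable_cylinder _ _ _ [set k | (k <= N)%N] eta
      (fun k => [set x k])).
  exact: (@measurable_cylinder _ _ _ [set k | (N < k <= N + m.+1)%N] eta
      (fun=> ~` slow_states a b)).
rewrite big_split_ord /= [X in (_ + X)%E]big1 ?adde0; last first.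
  move=> j _; rewrite -(@measure0 _ _ _ P); congr (P _).
  apply/seteqP; split=> // w [[_ /= H] e].
  by apply: (H N.+1); rewrite ?ltnS ?leqnn ?addnS ?ltnS ?leq_addr // e; exists j.
rewrite /survival /= mxE mulr_sumr -sumEFin; apply: eq_bigr => j _.
pose x' k := if (k <= N)%N then x k else lshift b j.
have x'N : x' N.+1 = lshift b j by rewrite /x' ltnn.
have x'E k : (k <= N)%N -> x' k = x k by rewrite /x' => ->.
have := IHm N.+1 x' j x'N; rewrite big_ord_recr /= x'N !x'E // xN.
have ulE : ulsubmx Om i j = Om (lshift b i) (lshift b j) by rewrite !mxE.
rewrite ulE -/(survival _ m) !mulrA => e.
have pE : \prod_(k < N) Om (x' k) (x' k.+1) = \prod_(k < N) Om (x k) (x k.+1).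
  by apply: eq_bigr => k _; rewrite !x'E // ltnW.
rewrite pE in e; rewrite -e; congr (P _).
apply/seteqP; split=> w /=.
  move=> [[H1 H2] H3]; split=> k.
    rewrite leq_eqVlt => /predU1P[->|kN]; first by rewrite x'N.
    by rewrite x'E ?H1.
  by move=> /andP[Nk kN]; apply: H2; rewrite ltnW // addnS -addSn.
move=> [H1 H2]; split; last by rewrite H1.
split=> k.
  by move=> kN; rewrite H1 ?leqW // x'E.
rewrite leq_eqVlt => /andP[/predU1P[<- _|Nk kN]].
  by rewrite H1 // x'N => -[l _ /eqP]; rewrite eq_rlshift.
by apply: H2; rewrite Nk addSn -addnS.
Qed.

(** Otherwise survival up to every time m has probability 1, so each event of being slow at time m
    is null. Their countable union is the event of a finite hitting time, which has probability
    1. *)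
Lemma dtmc_survival_lt1 i :
  mu = dirac_vec R (lshift b i) ->
  P [set w | (hitting_time R eta (slow_states a b) w < +oo)%E] = 1%E ->
  exists m, survival (ulsubmx Om) m i 0 < 1.
Proof.
have [meta _] := eta_chain.
move=> mui hit; apply: contrapT => nlt.
have S1 m : P ([set w | forall k, (k <= 0)%N -> eta k w = lshift b i] `&`
     [set w | forall k, (0 < k <= 0 + m)%N -> ~ slow_states a b (eta k w)]) = 1%E.
  have e := @dtmc_survival m 0 (fun=> lshift b i) i erefl.
  rewrite big_ord0 mulr1 {1}mui mxE !eqxx mul1r in e.
  apply/eqP; rewrite eq_le probability_le1 ?e ?lee_fin; last first.
    apply: measurableI.
      exact: (@measurable_cylinder _ _ _ [set k | (k <= 0)%N] eta
        (fun k => [set lshift b i])).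
    exact: (@measurable_cylinder _ _ _ [set k | (0 < k <= 0 + m)%N] eta
      (fun=> ~` slow_states a b)).
  by rewrite /= leNgt; apply/negP => lt1; apply: nlt; exists m.
pose B m := [set w | slow_states a b (eta m w)].
have mB m : measurable (B m).
  rewrite (_ : B m = [set w | forall k, k = m -> slow_states a b (eta k w)]).
    exact: (@measurable_cylinder _ _ _ [set m] eta (fun=> slow_states a b)).
  by apply/seteqP; split=> [w Bw k ->//|w H]; exact: H.
have B0 m : P (B m) = 0%E.
  have mC := measurableC (mB m).
  have C1 : P (~` B m) = 1%E.
    apply/eqP; rewrite eq_le probability_le1 //= -(S1 m) le_measure ?inE //.
      apply: measurableI.
        exact: (@measurable_cylinder _ _ _ [set k | (k <= 0)%N] eta
          (fun k => [set lshift b i])).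
      exact: (@measurable_cylinder _ _ _ [set k | (0 < k <= 0 + m)%N] eta
        (fun=> ~` slow_states a b)).
    move=> w [/= H1 H2]; rewrite /B /=.
    case: (posnP m) => [->|m0]; last by apply: H2; rewrite m0 leqnn.
    by rewrite H1 // => -[l _ /eqP]; rewrite eq_rlshift.
  by rewrite -(setCK (B m)) probability_setC // C1 subee.
have hitE : [set w | (hitting_time R eta (slow_states a b) w < +oo)%E] =
    \bigcup_m B m.
  apply/seteqP; split=> w /=.
    by move=> /ereal_inf_lt[_ [m Bm _] _]; exists m.
  by move=> [m _ Bm]; apply: le_lt_trans (ltry m%:R); apply: ereal_inf_lbound;
    exists m.
have : P (\bigcup_m B m) = 0%E.
  apply: measure_negligible; first exact: bigcupT_measurable.
  by apply: negligible_bigcup => m; apply/negligibleP; [exact: mB|exact: B0].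
by rewrite -hitE hit => -[] /eqP; rewrite oner_eq0.
Qed.

Lemma dtmc_ge0 i j : mu = dirac_vec R i -> 0 <= Om i j.
Proof.
have [_ fdd] := eta_chain => mui.
have := fdd 1%N (fun k => if k == 0%N then i else j).
rewrite big_ord1 /= mui mxE !eqxx mul1r => e.
by rewrite -lee_fin -e measure_ge0.
Qed.

End Survival.
End Laws.

(** * A maximum principle for K and the inverse of 1 - K *)

Section SubstochasticInverse.
Variables (R : realType) (a : nat) (K : 'M[R]_a).
Hypothesis K_ge0 : forall i j, 0 <= K i j.
Hypothesis K_exit : forall i, exists m, survival K m i 0 < 1.

(* If [x] is maximal at [i0] with [x i0 > 0], then
   [x i0 <= (K^m x) i0 <= x i0 * survival K m i0 < x i0]. *)
Lemma subharmonic_le0 (x : 'cV[R]_a) :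
  (forall i, x i 0 <= (K *m x) i 0) -> forall i, x i 0 <= 0.
Proof.
move=> xK i; pose i0 := [arg max_(j > i) x j 0]%O.
have x_max j : x j 0 <= x i0 0.
  by rewrite /i0; case: arg_maxP => // k _; apply.
apply: le_trans (x_max i) _; rewrite leNgt; apply/negP => x0.
have [m sm] := K_exit i0.
have : forall j, x j 0 <= x i0 0 * survival K m j 0.
  elim: {sm} m => [|m IHm] j; first by rewrite mxE mulr1.
  apply: le_trans (xK j) _; rewrite /survival iterS !mxE mulr_sumr.
  by apply: ler_sum => l _; rewrite mulrCA ler_wpM2l.
by move=> /(_ i0); rewrite leNgt -[ltRHS]mulr1 ltr_pM2l // sm.
Qed.

(** A vector in the kernel of 1 - K is K-invariant, so the maximum principle applies to it and to
    its opposite. *)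
Lemma substochastic_unit : 1%:M - K \in unitmx.
Proof.
rewrite -unitmx_tr -row_free_unit; apply: inj_row_free => v vK.
have vT : v^T = K *m v^T.
  apply/eqP; rewrite -subr_eq0 -{1}(mul1mx v^T) -mulmxBl.
  by rewrite -[1%:M - K]trmxK -trmx_mul vK trmx0.
have v_le0 := @subharmonic_le0 v^T.
have v_ge0 := @subharmonic_le0 (- v^T).
rewrite -(trmxK v); apply/rowP => i; rewrite !mxE; apply/eqP; rewrite eq_le.
have := v_le0 _ i; rewrite mxE => -> /=; last by move=> j; rewrite -vT.
have := v_ge0 _ i; rewrite !mxE oppr_le0; apply => j.
by rewrite mulmxN -vT.
Qed.

(** From w = K w + 1, the vector -w is subharmonic, so w >= 0; inserting this into the same equation
    gives w >= 1. *)
Lemma substochastic_inv_ge1 i :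
  1 <= (invmx (1%:M - K) *m const_mx 1 : 'cV_a) i 0.
Proof.
set w := invmx _ *m _.
have wE : w = K *m w + const_mx 1.
  apply/eqP; rewrite addrC -subr_eq -{1}(mul1mx w) -mulmxBl /w mulmxA.
  by rewrite mulmxV ?mul1mx // substochastic_unit.
have w_ge0 j : 0 <= w j 0.
  rewrite -oppr_le0; have := @subharmonic_le0 (- w) _ j; rewrite mxE; apply.
  move=> l; rewrite mulmxN {1}wE !mxE lerN2 lerDl ler01 //.
rewrite wE [leRHS]mxE [X in _ + X]mxE lerDr mxE sumr_ge0 // => j _.
by rewrite mulr_ge0.
Qed.

End SubstochasticInverse.

(** * Entrywise convergence of matrices *)

Section EntrywiseLimits.
Variables (R : realType) (I : Type) (F : set_system I).
Context {FF : ProperFilter F}.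

Definition mx_cvg m n (f : I -> 'M[R]_(m, n)) (l : 'M[R]_(m, n)) :=
  forall i j, f x i j @[x --> F] --> l i j.

Lemma mx_cvgD m n (f g : I -> 'M[R]_(m, n)) l l' :
  mx_cvg f l -> mx_cvg g l' -> mx_cvg (fun x => f x + g x) (l + l').
Proof.
move=> fl gl i j; rewrite mxE; under eq_fun do rewrite mxE.
exact: cvgD.
Qed.

Lemma mx_cvgBcst m n (f : I -> 'M[R]_(m, n)) l (A : 'M[R]_(m, n)) :
  mx_cvg f l -> mx_cvg (fun x => f x - A) (l - A).
Proof. by move=> fl; apply: mx_cvgD => // i j; exact: cvg_cst. Qed.

Lemma mx_cvgMcst m n k (f : I -> 'M[R]_(m, n)) l (A : 'M[R]_(n, k)) :
  mx_cvg f l -> mx_cvg (fun x => f x *m A) (l *m A).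
Proof.
move=> fl i j; rewrite mxE; under eq_fun do rewrite mxE.
apply: cvg_big => [|k' _]; first exact: add_continuous.
by apply: cvgM => //; exact: cvg_cst.
Qed.

Lemma mx_cvg_ulsub m1 m2 n1 n2 (f : I -> 'M[R]_(m1 + m2, n1 + n2)) l :
  mx_cvg f l -> mx_cvg (fun x => ulsubmx (f x)) (ulsubmx l).
Proof.
by move=> fl i j; rewrite !mxE; under eq_fun do rewrite !mxE; exact: fl.
Qed.

Lemma mx_cvg_ursub m1 m2 n1 n2 (f : I -> 'M[R]_(m1 + m2, n1 + n2)) l :
  mx_cvg f l -> mx_cvg (fun x => ursubmx (f x)) (ursubmx l).
Proof.
by move=> fl i j; rewrite !mxE; under eq_fun do rewrite !mxE; exact: fl.
Qed.

Lemma mx_cvg_near_le m n (f : I -> 'M[R]_(m, n)) l (c : R) j :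
  mx_cvg f l -> (forall i, l i j < c) ->
  \forall x \near F, forall i, f x i j <= c.
Proof.
move=> fl lc; apply: filter_forall => i.
by have /cvgr_le := fl i j; apply.
Qed.

Lemma mx_cvg0_l1_row m n (f : I -> 'M[R]_(m, n)) (e : R) :
  mx_cvg f 0 -> 0 < e -> \forall x \near F, forall i, l1 (row i (f x)) <= e.
Proof.
move=> f0 e0; apply: filter_forall => i.
suff /cvgr_le : l1 (row i (f x)) @[x --> F] --> (0 : R) by apply.
have -> : (0 : R) = \sum_(j < n) `|(0 : 'M[R]_(m, n)) i j|.
  by rewrite big1 // => j _; rewrite mxE normr0.
apply: cvg_big => [|j _]; first exact: add_continuous.
by under eq_fun do rewrite mxE; apply: cvg_norm; exact: f0.
Qed.

End EntrywiseLimits.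

(** * Limits of the rates and of the jump matrix *)

Section RateLimits.
Variables (R : realType) (n : nat) (Q : R -> 'M[R]_n).
Hypothesis Q_rate : forall lam, 0 < lam -> rate_matrix (Q lam).
Hypothesis Q_cvg :
  forall i j, i != j -> cvg ((Q lam i j)%:E @[lam --> +oo]).

Lemma near_pos : \forall lam \near +oo, 0 < lam :> R.
Proof. by apply: nbhs_pinfty_gt; exact: num_real. Qed.

(* [lim] of a divergent function is the default value [0], so a nonzero limit
   entails convergence. *)
Lemma exit_rate_cvg i : exit_rate_lim Q i != 0%E ->
  (exit_rate Q lam i)%:E @[lam --> +oo] --> exit_rate_lim Q i.
Proof.
by move=> neq0; apply: contrapT => ndiv; move/eqP: neq0; apply; exact: dvgP.
Qed.

Lemma exit_rate_pinfty i : exit_rate_lim Q i = +oo%E ->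
  exit_rate Q lam i @[lam --> +oo] --> +oo.
Proof.
by move=> e; apply/cvgeryP; have := @exit_rate_cvg i; rewrite e; apply.
Qed.

Lemma rate_le_exit lam i j : 0 < lam -> i != j ->
  0 <= Q lam i j <= exit_rate Q lam i.
Proof.
move=> lam0 ij; have [Q0 Q1] := Q_rate lam0; rewrite Q0 //=.
have := Q1 i; rewrite (bigD1 i) //= => /eqP; rewrite addrC addr_eq0.
rewrite /exit_rate => /eqP <-; rewrite (bigD1 j) 1?eq_sym //= lerDl.
by apply: sumr_ge0 => l /andP[li _]; rewrite Q0 // eq_sym.
Qed.

(** The diagonal entry is minus the exit rate. An off-diagonal entry lies between 0 and the exit
    rate, which is eventually bounded, so its extended limit is finite. *)
Lemma rate_cvg i j : (0 < exit_rate_lim Q i < +oo)%E ->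
  Q lam i j @[lam --> +oo] --> fine (rate_lim Q i j).
Proof.
move=> /andP[q_gt0 q_lty]; have q_cvg := exit_rate_cvg (negbT (gt_eqF q_gt0)).
have q_fin : exit_rate_lim Q i = (fine (exit_rate_lim Q i))%:E.
  by rewrite fineK // fin_real // q_lty andbT (lt_trans _ q_gt0) // ltNyr.
rewrite q_fin in q_cvg.
suff [l Ql] : exists l : R, (Q lam i j)%:E @[lam --> +oo] --> l%:E.
  rewrite mxE (cvg_lim _ Ql) //=; exact: (fine_cvg Ql).
have [<-|ij] := eqVneq i j.
  exists (- fine (exit_rate_lim Q i)); apply: cvg_EFin; first by near=> lam.
  rewrite (_ : _ \o _ = (fun lam => - exit_rate Q lam i)); last first.
    by apply/funext => lam /=; rewrite opprK.
  by apply: cvgN; exact: (fine_cvg q_cvg).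
have Ql := Q_cvg ij; set l := lim _ in Ql.
have l_fin : l \is a fin_num.
  rewrite ge0_fin_numE.
    apply: le_lt_trans (ltry (fine (exit_rate_lim Q i) + 1)).
    apply: cvge_le Ql; near=> lam; rewrite lee_fin.
    have lam0 : 0 < lam by near: lam; exact: near_pos.
    have /andP[_ Qe] := rate_le_exit lam0 ij; apply: le_trans Qe _.
    near: lam; apply: cvgr_le; first exact: (fine_cvg q_cvg).
    by rewrite ltrDl.
  apply: cvge_ge Ql; near=> lam; rewrite lee_fin.
  have lam0 : 0 < lam by near: lam; exact: near_pos.
  by have /andP[] := rate_le_exit lam0 ij.
by exists (fine l); rewrite fineK.
Unshelve. all: by end_near. Qed.

Lemma jump_cvg :
  (forall i j, i != j -> cvg (jump_matrix Q lam i j @[lam --> +oo])) ->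
  mx_cvg +oo (jump_matrix Q) (jump_lim Q).
Proof.
move=> J_cvg i j; rewrite [jump_lim Q i j]mxE; have [<-|ij] := eqVneq i j.
  have -> : (fun lam => jump_matrix Q lam i i) = (fun=> 0).
    by apply/funext => lam; rewrite mxE eqxx.
  by rewrite lim_cst //; exact: cvg_cst.
exact: J_cvg.
Qed.

(** The factorization Q = diag(q) (Omega(lambda) - 1) isolates the diverging exit rates of fast rows
    from a factor that converges. *)
Lemma rateE lam i j : exit_rate Q lam i != 0 ->
  Q lam i j = exit_rate Q lam i * (jump_matrix Q lam i j - (i == j)%:R).
Proof.
move=> q0; rewrite mxE; have [<-|ij] := eqVneq i j.
  by rewrite sub0r mulrN1 opprK.
by rewrite subr0 mulrC divfK.
Qed.

End RateLimits.

(** * Choice of the constants and convergence for large [lam] *)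

Theorem corollary1 (R : realType) (a b : nat) (b_gt0 : (0 < b)%N)
  (Q : R -> 'M[R]_(a + b))
  (Q_rate : forall lam, 0 < lam -> rate_matrix (Q lam))
  (Q_irr : forall lam, 0 < lam -> irreducible_rates (Q lam))
  (Q_cvg : forall i j, i != j -> cvg ((Q lam i j)%:E @[lam --> +oo]))
  (fast : forall i : 'I_a, exit_rate_lim Q (lshift b i) = +oo%E)
  (slow : forall i : 'I_b, (0 < exit_rate_lim Q (rshift a i) < +oo)%E)
  (Om_cvg : forall i j, i != j -> cvg (jump_matrix Q lam i j @[lam --> +oo]))
  (deta : measure_display) (Eeta : measurableType deta)
  (Peta : 'I_(a + b) -> probability Eeta R)
  (eta : nat -> Eeta -> 'I_(a + b))
  (eta_chain : forall i, is_dtmc (Peta i) (dirac_vec R i) (jump_lim Q) eta)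
  (hit_slow : forall i : 'I_a,
    Peta (lshift b i)
      [set w | (hitting_time R eta (slow_states a b) w < +oo)%E] = 1%E)
  (pi : 'rV[R]_b) (pi_prob : prob_vec pi)
  (dX : measure_display) (EX : measurableType dX)
  (PX : R -> probability EX R) (X : R -> EX -> 'I_(a + b))
  (X_chain : forall lam, 0 < lam -> is_ctmc (PX lam) (slow_vec a pi) (Q lam) X)
  (dY : measure_display) (EY : measurableType dY)
  (PY : probability EY R) (Y : R -> EY -> 'I_b)
  (Y_chain : is_ctmc PY pi (reduced_rates Q) Y)
  (T : R) (T_gt0 : 0 < T) :
  sup [set dTV (law_of (PX lam) (X t)) (slow_vec a (law_of PY (Y t)))
         | t in [set t | 0 <= t <= T]] @[lam --> +oo] --> (0 : R).
Proof.
pose Om := jump_lim Q; pose K := ulsubmx Om; pose G := reduced_rates Q.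
pose N : 'M[R]_a := invmx (1%:M - K); pose H := N *m ursubmx Om.
pose w : 'cV[R]_a := N *m const_mx 1.
have K_ge0 i j : 0 <= K i j.
  have := dtmc_ge0 (eta_chain (lshift b i)) (lshift b j) erefl.
  by rewrite /K !mxE.
have K_exit i : exists m, survival K m i 0 < 1.
  exact: (dtmc_survival_lt1 (eta_chain (lshift b i)) erefl (hit_slow i)).
have K_unit := substochastic_unit K_ge0 K_exit.
have w_ge1 : forall i, 1 <= w i 0 := substochastic_inv_ge1 K_ge0 K_exit.
have [P [tP PG lawY]] := law_of_ctmc Y_chain.
pose QBA := map_mx fine (dlsubmx (rate_lim Q)).
pose QBB := map_mx fine (drsubmx (rate_lim Q)).
have QBA_cvg : mx_cvg +oo (fun lam => dlsubmx (Q lam)) QBA.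
  move=> i j; rewrite /QBA; under eq_fun do rewrite !mxE.
  have := @rate_cvg _ _ Q Q_rate Q_cvg (rshift a i) (lshift b j) (slow i).
  by rewrite !mxE.
have QBB_cvg : mx_cvg +oo (fun lam => drsubmx (Q lam)) QBB.
  move=> i j; rewrite /QBB; under eq_fun do rewrite !mxE.
  have := @rate_cvg _ _ Q Q_rate Q_cvg (rshift a i) (rshift a j) (slow i).
  by rewrite !mxE.
have J_cvg := jump_cvg Om_cvg.
have JAA_cvg : mx_cvg +oo (fun lam => ulsubmx (jump_matrix Q lam) - 1%:M)
    (K - 1%:M).
  by apply: mx_cvgBcst; exact: mx_cvg_ulsub.
(* K - 1 is minus the inverse of N; this gives (K - 1) w = -1 and (K - 1) H = -Omega_AB. *)
have KN m (A : 'M[R]_(a, m)) : (K - 1%:M) *m (N *m A) = - A.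
  by rewrite -opprB mulNmx mulmxA mulmxV // mul1mx.
(* Crude bounds by sums. The added 1 makes [W] positive even without fast states, makes the bound by
   [C] strict so that it survives passage to finite [lam], and gives c >= 1. *)
pose W := 1 + \sum_i w i 0; pose C := 1 + \sum_i `|(QBA *m w) i 0|.
pose c := 1 + \sum_i l1 (row i H) + \sum_i l1 (row i (H *m G)).
have w_ge0 i : 0 <= w i 0 by apply: le_trans (w_ge1 i).
have sum_ge (I : finType) (f : I -> R) i :
    (forall j, 0 <= f j) -> f i <= \sum_j f j.
  by move=> f0; rewrite (bigD1 i) //= lerDl sumr_ge0.
have W_gt0 : 0 < W by rewrite ltr_wpDr // sumr_ge0.
have wW i : w i 0 <= W.
  by rewrite (le_trans (sum_ge _ (fun i => w i 0) i _)) // lerDr.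
have C_ge0 : 0 <= C by rewrite addr_ge0 // sumr_ge0.
have lC i : (QBA *m w) i 0 < C.
  rewrite (le_lt_trans (ler_norm _)) //.
  by rewrite (le_lt_trans (sum_ge _ (fun i => `|(QBA *m w) i 0|) i _)) // ltrDr.
have sH : 0 <= \sum_i l1 (row i H) by apply: sumr_ge0 => i _; exact: l1_ge0.
have sHG : 0 <= \sum_i l1 (row i (H *m G)).
  by apply: sumr_ge0 => i _; exact: l1_ge0.
have c_ge1 : 1 <= c by rewrite /c; lra.
have H_le i : l1 (row i H) <= c.
  have := sum_ge _ (fun i => l1 (row i H)) i (fun=> l1_ge0 _).
  rewrite /c; lra.
have HG_le i : l1 (row i (H *m G)) <= c.
  have := sum_ge _ (fun i => l1 (row i (H *m G))) i (fun=> l1_ge0 _).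
  rewrite /c; lra.
(* The factor of eta in [semigroup_comparison]; taking eta0 = e / B turns that bound into e. *)
pose B := 1 + c + T * (2 * C + 3 + 3 * c).
have B_gt0 : 0 < B.
  have : 0 <= T * (2 * C + 3 + 3 * c) by rewrite mulr_ge0 ?(ltW T_gt0) //; lra.
  rewrite /B; lra.
apply/cvgr0Pnorm_le => e e_gt0; pose eta0 := e / B.
have eta0_gt0 : 0 < eta0 by rewrite divr_gt0.
(* Gives equality in the condition 2 W (C + 1) <= eta0 k; every fast exit rate eventually exceeds
   this k. *)
pose k := 2 * W * (C + 1) / eta0.
have k_gt0 : 0 < k by rewrite divr_gt0 // !mulr_gt0 //; lra.
have near_q : \forall lam \near +oo, forall i, k <= exit_rate Q lam (lshift b i).
  apply: filter_forall => i.
  by have /cvgryPge := exit_rate_pinfty (fast i); exact.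
(* The limit is -1, so -1/2 leaves room; multiplying by the exit rate gives the drift -q/2. *)
have near_w : \forall lam \near +oo, forall i,
    ((ulsubmx (jump_matrix Q lam) - 1%:M) *m w) i 0 <= - 2^-1.
  apply: mx_cvg_near_le; first exact: mx_cvgMcst JAA_cvg.
  by move=> i; rewrite /w KN !mxE; lra.
have near_H : \forall lam \near +oo, forall i,
    l1 (row i ((ulsubmx (jump_matrix Q lam) - 1%:M) *m H
               + ursubmx (jump_matrix Q lam))) <= eta0.
  apply: mx_cvg0_l1_row => //.
  rewrite (_ : 0 = (K - 1%:M) *m H + ursubmx Om); last first.
    by rewrite /H KN addNr.
  apply: mx_cvgD; first exact: mx_cvgMcst JAA_cvg.
  exact: mx_cvg_ursub.
have near_C : \forall lam \near +oo, forall i, (dlsubmx (Q lam) *m w) i 0 <= C.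
  by apply: mx_cvg_near_le lC; exact: mx_cvgMcst.
have near_G : \forall lam \near +oo, forall i,
    l1 (row i (dlsubmx (Q lam) *m H + drsubmx (Q lam) - G)) <= eta0.
  apply: mx_cvg0_l1_row => //.
  (* The limit vanishes because Gamma is by definition Q_BB + Q_BA H. *)
  rewrite (_ : 0 = QBA *m H + QBB - G); last first.
    by rewrite /G /reduced_rates -/Om -/QBA -/QBB /H mulmxA [QBB + _]addrC subrr.
  by apply: mx_cvgBcst; apply: mx_cvgD => //; exact: mx_cvgMcst.
near=> lam.
have lam_gt0 : 0 < lam by near: lam; exact: near_pos.
have q_large : forall i, k <= exit_rate Q lam (lshift b i) by near: lam.
have q_neq0 i : exit_rate Q lam (lshift b i) != 0.
  by rewrite gt_eqF // (lt_le_trans k_gt0).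
have QAA i m (A : 'M[R]_(a, m)) j : (ulsubmx (Q lam) *m A) i j =
    exit_rate Q lam (lshift b i)
    * ((ulsubmx (jump_matrix Q lam) - 1%:M) *m A) i j.
  rewrite !mxE mulr_sumr; apply: eq_bigr => l _.
  have -> : ulsubmx (Q lam) i l = Q lam (lshift b i) (lshift b l).
    by rewrite !mxE.
  rewrite rateE // eq_lshift mulrA.
  by congr (_ * _ * _); rewrite !mxE ?eq_lshift.
have QAB i : row i (ursubmx (Q lam)) =
    exit_rate Q lam (lshift b i) *: row i (ursubmx (jump_matrix Q lam)).
  apply/rowP => j.
  have -> : row i (ursubmx (Q lam)) 0 j = Q lam (lshift b i) (rshift a j).
    by rewrite !mxE.
  by rewrite rateE // eq_lrshift subr0 !mxE.
(* [p] depends on [lam], with no uniformity in its expansion at 0. The mesh is chosen afterwards for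
   each [lam] and t, and does not enter the bound. *)
have [p [tp pQ lawX]] := law_of_ctmc (X_chain _ lam_gt0).
have dist_le t : 0 <= t <= T ->
    dTV (law_of (PX lam) (X t)) (slow_vec a (law_of PY (Y t))) <= e.
  move=> /[dup] tT /andP[t_ge0 _]; rewrite lawX // lawY //.
  rewrite -[leRHS](@divfK _ B) ?gt_eqF // -/eta0.
  apply: (@semigroup_comparison R a b p P (Q lam) G H w
    (fun i => exit_rate Q lam (lshift b i)) eta0 k W C c) => //.
  - move=> i; rewrite QAA -mulrN ler_wpM2l ?(le_trans (ltW k_gt0)) //.
    by move: i; near: lam.
  - by near: lam.
  - move=> i.
    have -> : row i (ulsubmx (Q lam) *m H + ursubmx (Q lam)) =
        exit_rate Q lam (lshift b i) *:
        row i ((ulsubmx (jump_matrix Q lam) - 1%:M) *m H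
               + ursubmx (jump_matrix Q lam)).
      rewrite linearD /= QAB linearD /= scalerDr; congr (_ + _).
      by apply/rowP => j; rewrite mxE QAA !mxE.
    rewrite l1Z ger0_norm ?(le_trans (ltW k_gt0)) //.
    rewrite ler_wpM2l ?(le_trans (ltW k_gt0)) //.
    by move: i; near: lam.
  - by near: lam.
  - by rewrite /k [leRHS]mulrC divfK ?gt_eqF.
have dist_ge0 t :
    0 <= dTV (law_of (PX lam) (X t)) (slow_vec a (law_of PY (Y t))).
  by rewrite mulr_ge0 // sumr_ge0.
have T0 : [set t | 0 <= t <= T] (0 : R) by rewrite /= lexx ltW.
(* The real supremum is controlled through a nonempty set bounded above: t = 0 gives a point,
   [dist_le] the bound. *)
rewrite ger0_norm.
  apply: ge_sup; first by eexists; exists 0.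
  by move=> _ [t tT <-]; exact: dist_le.
apply: le_trans (dist_ge0 0) _; apply: ub_le_sup; last by exists 0.
by exists e => _ [t tT <-]; exact: dist_le.
Unshelve. all: by end_near. Qed.
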